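(* For every nonnegative integer $N$, the rooted trees $\mathbb{T}_N^{\breve{\mathcal{G}},\breve{V}}$ and $\mathbb{T}_N^{\breve{\mathcal{T}},\breve{u}}$ are isomorphic, where the correspondence between the vertices is given by the bijections $$\breve{\mathsf{ST}}_{k+1}:\breve{\mathcal{G}}_k\to\breve{\mathrm{TY}}_{k+2}=\breve{\mathcal{T}}_{k+2},\qquad k=0,1,\dots,N,$$ from the set of level $k$ vertices of the first tree to the set of level $k$ vertices of the second.
   Context: Notation. $[m]=\{1,\dots,m\}$. $\binom{i}{j}$ denotes an ordered pair (not a binomial coefficient). $[\![P]\!]$ is $1$ if $P$ is true and $0$ otherwise. Generalized Farey intervals. For integers $m,n\ge 0$ let $G_{m,n}=\{0,\infty\}$ if $mn=0$ and $G_{m,n}=\{0,\infty\}\cup\{p/q: p\in[m],q\in[n]\}$ otherwise. $G^{\mathrm{int}}_{m,n}$ is the set of open intervals $(a,b)$ with $a<b$ consecutive elements of $G_{m,n}$ (in increasing order). $\mathcal{G}_{m,n}=\{((a,b),\binom{m}{n}):(a,b)\in G^{\mathrm{int}}_{m,n}\}$ and $\breve{\mathcal{G}}_k=\bigsqcup_{m,n\ge0,\,m+n=k}\mathcal{G}_{m,n}$. The map $\breve V_k:\breve{\mathcal{G}}_k\to\breve{\mathcal{G}}_{k-1}$ ($k\ge1$) is defined on $((a,b),\binom{m}{n})\in\mathcal{G}_{m,n}$, $m+n=k$, as follows. If $m=0$: $((0,\infty),\binom{0}{n})\mapsto((0,\infty),\binom{0}{n-1})$. If $n=0$: $((0,\infty),\binom{m}{0})\mapsto((0,\infty),\binom{m-1}{0})$.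 If $mn\ge1$, exactly one of the following four cases occurs, and $$((a,b),\tbinom{m}{n})\mapsto\begin{cases}((a,b),\binom{m-1}{n})& b<\frac mn,\\ ((a,\min\{c\in G_{m-1,n}:a<c\}),\binom{m-1}{n})& b=\frac mn,\\ ((\max\{c\in G_{m,n-1}:c<b\},b),\binom{m}{n-1})& a=\frac mn,\\ ((a,b),\binom{m}{n-1})& a>\frac mn.\end{cases}$$ This map is known to be well defined and surjective. Terminal pairs of difference equation type. For $m,n\ge1$, $\mathcal{E}^{1,\mathrm{in}}_{m,n}$ is the set of injections $f:([m]\times\{1\})\cup(\{1\}\times[n])\to[mn]$ with $f(1,1)=1$ such that $f(i+1,1)-f(i,1)=\sum_{t\in[n]}[\![f(1,t)\le f(i+1,1)]\!]$ for all $i\in[m-1]$ and $f(1,j+1)-f(1,j)=\sum_{s\in[m]}[\![f(s,1)\le f(1,j+1)]\!]$ for all $j\in[n-1]$. Let $\mathcal{T}^{1,\mathrm{in}}_{m,n}=\{(f(m,1),f(1,n),\binom{m}{n}):f\in\mathcal{E}^{1,\mathrm{in}}_{m,n}\}$ and $\breve{\mathcal{T}}_k=\bigsqcup_{m,n\ge1,\,m+n=k}\mathcal{T}^{1,\mathrm{in}}_{m,n}$ for $k\ge2$. For $k\ge3$ the map $\breve u_k:\breve{\mathcal{T}}_k\to\breve{\mathcal{T}}_{k-1}$ sends $(s,t,\binom{m}{n})$ to $(s-n,t,\binom{m-1}{n})$ if $s>t$ and to $(s,t-m,\binom{m}{n-1})$ if $s<t$ (known to be well defined and surjective). Young terminal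 pairs. For $m,n\ge1$ and real $\xi>0$ let $\tau^{m,n}_{1,\xi}:[m]\times[n]\to[mn]$, $\tau^{m,n}_{1,\xi}(i,j)=\sum_{s\in[m]}\sum_{t\in[n]}[\![s+t\xi\le i+j\xi]\!]$. $\mathrm{Y}_{m,n}$ is the set of those $\tau^{m,n}_{1,\xi}$ ($\xi>0$) that are injective. $\mathrm{TY}_{m,n}=\{(\theta(m,1),\theta(1,n),\binom{m}{n}):\theta\in\mathrm{Y}_{m,n}\}$ and $\breve{\mathrm{TY}}_k=\bigsqcup_{m,n\ge1,\,m+n=k}\mathrm{TY}_{m,n}$ for $k\ge 2$. For $k\ge2$, the map $\breve{\mathsf{ST}}_{k-1}:\breve{\mathcal{G}}_{k-2}\to\breve{\mathrm{TY}}_k$ sends $((a,b),\binom{m-1}{n-1})$ (with $m,n\ge1$, $m+n=k$) to $(\tau^{m,n}_{1,\xi}(m,1),\tau^{m,n}_{1,\xi}(1,n),\binom{m}{n})$ for any $\xi\in(a,b)$ (the value does not depend on the choice of $\xi$; this map is known to be a well-defined bijection). Trees. $\mathbb{T}_N^{\breve{\mathcal{G}},\breve V}$ is the rooted tree whose set of level $k$ vertices is $\breve{\mathcal{G}}_k$ ($0\le k\le N$), with root $((0,\infty),\binom{0}{0})$, where for $k<k'$ the vertices $v\in\breve{\mathcal{G}}_k$, $v'\in\breve{\mathcal{G}}_{k'}$ are adjacent iff $k'=k+1$ and $\breve V_{k'}(v')=v$. $\mathbb{T}_N^{\breve{\mathcal{T}},\breve u}$ is the rooted tree whose set of level $k$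 vertices is $\breve{\mathcal{T}}_{k+2}$ ($0\le k\le N$), with root $(1,1,\binom{1}{1})$, where for $k<k'$ the vertices $v\in\breve{\mathcal{T}}_{k+2}$, $v'\in\breve{\mathcal{T}}_{k'+2}$ are adjacent iff $k'=k+1$ and $\breve u_{k'+2}(v')=v$. *)

(* Defs.v *)
From mathcomp Require Import all_boot all_order all_algebra.
From mathcomp Require Import all_classical all_reals.

Set Implicit Arguments.
Unset Strict Implicit.
Unset Printing Implicit Defensive.

Import Order.TTheory GRing.Theory Num.Theory.

Local Open Scope classical_set_scope.
Local Open Scope ring_scope.

(** * Rooted graphs and trees *)

Record rooted_graph := RootedGraph {
  vtx : eqType;
  vset : set vtx;
  adj : rel vtx;
  tree_root : vtx }.

(* Simple undirected graph on [vset] in which any two vertices are joined by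
   exactly one path without repeated vertices. *)
Definition is_rooted_tree (T : rooted_graph) : Prop :=
  [/\ vset (tree_root T),
      forall x y : vtx T, adj x y -> vset x /\ vset y,
      irreflexive (@adj T), symmetric (@adj T) &
      forall x y : vtx T, vset x -> vset y ->
        exists! p : seq (vtx T),
          [/\ path (@adj T) x p, uniq (x :: p) & last x p = y]].

Definition is_rooted_iso (T1 T2 : rooted_graph) (f : vtx T1 -> vtx T2) : Prop :=
  [/\ set_bij (@vset T1) (@vset T2) f,
      f (tree_root T1) = tree_root T2 &
      forall x y : vtx T1, vset x -> vset y -> adj (f x) (f y) = adj x y].

(* The rooted graph with level sets [L 0], ..., [L N]; vertices of levels
   k < k' are adjacent iff k' = k+1 and [p] maps the one of level k' to the one
   of level k. *)
Definition level_graph (T : eqType) (N : nat) (L : nat -> set T) (p : T -> T)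
    (r : T) : rooted_graph :=
  let child_of (v v' : T) := exists k k' : nat,
    [/\ (k < k' <= N)%N, L k v, L k' v', k' = k.+1 & p v' = v] in
  {| vtx := T;
     vset := \bigcup_(k in [set k | (k <= N)%N]) L k;
     adj := fun x y => `[< child_of x y \/ child_of y x >];
     tree_root := r |}.

(** * Generalized Farey intervals *)

Section Farey.
Variable R : realType.
Local Open Scope ereal_scope.

Definition Gset (m n : nat) : set (\bar R) :=
  if (m * n == 0)%N then [set 0; +oo]
  else [set 0; +oo] `|`
       [set x | exists p q : nat, [/\ (1 <= p <= m)%N, (1 <= q <= n)%N &
                                      x = (p%:R / q%:R)%R%:E]].

(* An open interval (a, b) is represented by the pair of its endpoints. *)
Definition Gint (m n : nat) : set (\bar R * \bar R) :=
  [set ab | [/\ Gset m n ab.1, Gset m n ab.2, ab.1 < ab.2 &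
                forall c, Gset m n c -> ~ (ab.1 < c < ab.2)]].

Definition Gvertex : Type := ((\bar R * \bar R) * (nat * nat))%type.

Definition Gcal (m n : nat) : set Gvertex :=
  [set v | Gint m n v.1 /\ v.2 = (m, n)].

Definition Gbreve (k : nat) : set Gvertex :=
  \bigcup_(mn in [set mn : nat * nat | mn.1 + mn.2 = k]%N) Gcal mn.1 mn.2.

(* The least, resp. greatest, element of a set of extended reals (arbitrary if
   there is none). *)
Definition set_min (A : set (\bar R)) : \bar R := xget 0 (A `&` lbound A).
Definition set_max (A : set (\bar R)) : \bar R := xget 0 (A `&` ubound A).

(* The formula does not involve the level k; only the values on [Gbreve k]
   with k >= 1 matter. *)
Definition Vbreve (v : Gvertex) : Gvertex :=
  let: ((a, b), (m, n)) := v in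
  if m == 0%N then ((0, +oo), (0, n.-1)%N)
  else if n == 0%N then ((0, +oo), (m.-1, 0)%N)
  else
    let r := (m%:R / n%:R)%R%:E in
    if b < r then ((a, b), (m.-1, n))
    else if b == r then ((a, set_min [set c | Gset m.-1 n c /\ a < c]), (m.-1, n))
    else if a == r then ((set_max [set c | Gset m n.-1 c /\ c < b], b), (m, n.-1))
    else (* r < a *) ((a, b), (m, n.-1)).

Definition Groot : Gvertex := ((0, +oo), (0, 0)%N).

End Farey.

(** * Terminal pairs of difference equation type *)

Definition Tvertex : Type := ((nat * nat) * (nat * nat))%type.

(* Functions on [m] x [n], or on a part of it, are represented by functions on
   nat * nat, with 1-based indices; values outside the domain are never used. *)
Definition box (m n : nat) : set (nat * nat) :=
  [set ij | (1 <= ij.1 <= m)%N /\ (1 <= ij.2 <= n)%N].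

Definition E1in (m n : nat) : set (nat * nat -> nat) :=
  [set f | [/\ set_fun (box m 1 `|` box 1 n) [set y | (1 <= y <= m * n)%N] f,
               set_inj (box m 1 `|` box 1 n) f,
               f (1, 1)%N = 1%N,
               forall i : nat, (1 <= i <= m.-1)%N ->
                 (f (i.+1, 1)%N)%:Z - (f (i, 1)%N)%:Z =
                 (\sum_(1 <= t < n.+1) (f (1, t) <= f (i.+1, 1)))%N%:Z &
               forall j : nat, (1 <= j <= n.-1)%N ->
                 (f (1, j.+1)%N)%:Z - (f (1, j)%N)%:Z =
                 (\sum_(1 <= s < m.+1) (f (s, 1) <= f (1, j.+1)))%N%:Z]].

Definition T1in (m n : nat) : set Tvertex :=
  [set ((f (m, 1), f (1, n)), (m, n))%N | f in E1in m n].

Definition Tbreve (k : nat) : set Tvertex :=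
  \bigcup_(mn in [set mn : nat * nat | [/\ 1 <= mn.1, 1 <= mn.2 & mn.1 + mn.2 = k]%N])
    T1in mn.1 mn.2.

(* Only the values on [Tbreve k] with k >= 3 matter; there s <> t, and the
   subtractions are not truncated. *)
Definition ubreve (v : Tvertex) : Tvertex :=
  let: ((s, t), (m, n)) := v in
  if (t < s)%N then ((s - n, t), (m.-1, n))%N
  else ((s, t - m), (m, n.-1))%N.

Definition Troot : Tvertex := ((1, 1), (1, 1))%N.

(** * Young terminal pairs *)

Section Young.
Variable R : realType.

Definition tau (m n : nat) (xi : R) (ij : nat * nat) : nat :=
  (\sum_(1 <= s < m.+1) \sum_(1 <= t < n.+1)
     (s%:R + t%:R * xi <= ij.1%:R + ij.2%:R * xi)%R)%N.

Definition Yset (m n : nat) : set (nat * nat -> nat) :=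
  [set theta | exists xi : R,
     [/\ 0 < xi, theta = tau m n xi & set_inj (box m n) theta]].

Definition TY (m n : nat) : set Tvertex :=
  [set ((theta (m, 1), theta (1, n)), (m, n))%N | theta in Yset m n].

Definition TYbreve (k : nat) : set Tvertex :=
  \bigcup_(mn in [set mn : nat * nat | [/\ 1 <= mn.1, 1 <= mn.2 & mn.1 + mn.2 = k]%N])
    TY mn.1 mn.2.

(* The terminal pair computed with a given xi. *)
Definition STat (xi : R) (mn : nat * nat) : Tvertex :=
  let m := mn.1.+1 in let n := mn.2.+1 in
  ((tau m n xi (m, 1%N), tau m n xi (1%N, n)), (m, n)).

(* The formula does not involve the level; xi is some element of the interval
   (a, b). *)
Definition STbreve (v : Gvertex R) : Tvertex :=
  let: ((a, b), mn) := v in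
  STat (xget 1 [set xi : R | (a < xi%:E < b)%E]) mn.

End Young.

Definition TreeGV (R : realType) (N : nat) : rooted_graph :=
  level_graph N (@Gbreve R) (@Vbreve R) (Groot R).

Definition TreeTu (N : nat) : rooted_graph :=
  level_graph N (fun k => Tbreve k.+2) ubreve Troot.

(* Main.v *)
(* For x in a Farey interval of G_{m,n}, the terminal pair of tau^{m+1,n+1}_x counts
   the lattice points (p, q) of [0,m] x [0,n] with q x <= p, resp. p <= q x. These
   counts depend only on the interval, and the first one strictly decreases from
   each interval to the next, so ST is injective. By the half-turn of the box the
   first count is the larger one iff n x < m; then the points with p = m
   contribute n + 1 to it and 0 to the other, which is exactly what u subtracts,
   while V passes to the interval of G_{m-1,n} around x. Finally, a solution f of
   the difference equations with f(m,1) > f(1,n) restricts to [m-1] x [n], so by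
   induction its terminal pair is that of some tau_x, and x can be moved inside
   its interval below the new fractions. *)
Require Import Defs.
From mathcomp Require Import all_boot all_order all_algebra.
From mathcomp Require Import all_classical all_reals.
From mathcomp Require Import zify ring lra.

Set Implicit Arguments.
Unset Strict Implicit.
Unset Printing Implicit Defensive.

Import Order.TTheory GRing.Theory Num.Theory.

Local Open Scope classical_set_scope.
Local Open Scope ring_scope.

(** * Level graphs *)

Lemma simple_loop_nil (T : eqType) (x : T) s : uniq (x :: s) -> last x s = x -> s = [::].
Proof.
case: s => // z s /= /andP[/negP nx _] ez; case: nx.
by rewrite -{1}ez mem_last.
Qed.

Section LevelGraph.
Variables (T : eqType) (N : nat) (L : nat -> set T) (p : T -> T) (r : T).
Hypothesis L0 : L 0 = [set r].
Hypothesis Lp : forall k v, L k.+1 v -> L k (p v).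
Hypothesis L_inj : forall k k' v, L k v -> L k' v -> k = k'.

Local Notation G := (level_graph N L p r).

Lemma level_adjP x y :
  reflect ((exists k, [/\ (k < N)%N, L k x, L k.+1 y & p y = x]) \/
           (exists k, [/\ (k < N)%N, L k y, L k.+1 x & p x = y]))
          (adj (r := G) x y).
Proof.
apply: (iffP idP).
  by move=> /asboolP[] [k [k' [/andP[kk' kN] Lx Ly ek pyx]]]; subst k';
    [left|right]; exists k.
move=> H; apply/asboolP; case: H => -[k [kN Lx Ly pyx]]; [left|right];
  by exists k, k.+1; rewrite ltnSn.
Qed.

Lemma level_adj_sym : symmetric (adj (r := G)).
Proof. by move=> x y; apply/level_adjP/level_adjP => -[]; [right|left|right|left]. Qed.

(** After a step from a parent down to a child, a simple path cannot turn back: the only vertex one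
    level up is the parent just left. So the level keeps rising. *)
Lemma descending_path k x c q : L k x -> L k.+1 c -> p c = x ->
  path (adj (r := G)) c q -> uniq [:: x, c & q] ->
  exists2 l, (k < l)%N & L l (last c q).
Proof.
elim: q k x c => [|d q IH] k x c Lx Lc pc; first by exists k.+1.
case/andP=> /level_adjP cd dq; rewrite cons_uniq => /andP[].
rewrite !inE !negb_or => /and3P[_ xd _] u.
case: cd => -[j [jN Lj Lj' e]].
  have ej := L_inj Lc Lj; subst j.
  have [l kl Ll] := IH _ _ _ Lc Lj' e dq u.
  by exists l => //; apply: ltn_trans kl.
by move: xd; rewrite -pc e eqxx.
Qed.

(** A path that starts with a step to a child ends at a level beyond k, by [descending_path]. Since
    y has level at most k, the first step goes to the parent. *)
Lemma simple_path_parent k l x y q : L k x -> L l y -> (l <= k)%N -> x != y ->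
  path (adj (r := G)) x q -> uniq (x :: q) -> last x q = y ->
  exists q', q = p x :: q' /\ exists2 j, k = j.+1 & L j (p x).
Proof.
move=> Lx Ly lk xy; case: q => [|c q]; first by move=> _ _ /= e; rewrite e eqxx in xy.
case/andP=> /level_adjP xc cq u /= e.
case: xc => -[j [jN Lj Lj' e']]; last first.
  have ej := L_inj Lx Lj'; subst k.
  by exists q; rewrite e'; split => //; exists j.
have [i ji] := descending_path Lj Lj' e' cq u.
rewrite e => Li; have := L_inj Lx Lj; have := L_inj Ly Li; lia.
Qed.

(** Induction on the sum of the two levels: at the end of larger level the first step is forced, and
    removing it lowers the sum. *)
Lemma simple_path_unique x y k l q q' : L k x -> L l y ->
  path (adj (r := G)) x q -> uniq (x :: q) -> last x q = y ->
  path (adj (r := G)) x q' -> uniq (x :: q') -> last x q' = y ->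
  q = q'.
Proof.
move: {2}(k + l)%N (leqnn (k + l)) => h.
elim: h x y k l q q' => [|h IH] x y k l q q' hkl Lx Ly.
  have [k0 l0] : k = 0%N /\ l = 0%N by lia.
  subst k l; move: Lx Ly; rewrite L0 /= => -> -> _ u e _ u' e'.
  by rewrite (simple_loop_nil u e) (simple_loop_nil u' e').
have [<-{y Ly}|xy] := eqVneq x y.
  by move=> _ u e _ u' e'; rewrite (simple_loop_nil u e) (simple_loop_nil u' e').
have main a b i j s s' : (i + j <= h.+1)%N -> L i a -> L j b -> (j <= i)%N ->
    a != b -> path (adj (r := G)) a s -> uniq (a :: s) -> last a s = b ->
    path (adj (r := G)) a s' -> uniq (a :: s') -> last a s' = b -> s = s'.
  move=> hij La Lb ji ab ps us es ps' us' es'.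
  have [t [et [i' ei Lpa]]] := simple_path_parent La Lb ji ab ps us es.
  have [t' [et' _]] := simple_path_parent La Lb ji ab ps' us' es'.
  subst s s' i; congr cons.
  case/andP: ps => _ pt; case/andP: ps' => _ pt'.
  case/andP: us => _ ut; case/andP: us' => _ ut'.
  exact: (IH (p a) b i' j).
case: (leqP l k) => [lk|/ltnW kl]; first exact: (main x y k l).
move=> ps us es ps' us' es'.
(* When y has the larger level, both paths are reversed so that they start there. *)
have rpath s : last x s = y -> path (adj (r := G)) x s ->
    path (adj (r := G)) y (rev (belast x s)).
  by move=> e ps0; rewrite -e rev_path;
    move: ps0; apply: sub_path => z w; rewrite level_adj_sym.
have runiq s : last x s = y -> uniq (x :: s) -> uniq (y :: rev (belast x s)).
  by move=> e; rewrite -e -rev_rcons -lastI rev_uniq.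
have rlast s : last x s = y -> last y (rev (belast x s)) = x.
  case: s => [/= ->//|z s _].
  by rewrite /= rev_cons last_rcons.
have : rev (belast x q) = rev (belast x q').
  apply: (main y x l k) => //; rewrite ?(addnC l) ?(eq_sym y) //; by auto.
move=> /(congr1 rev); rewrite !revK => eb.
have : x :: q = x :: q' by rewrite !lastI eb es es'.
by case.
Qed.

Lemma level_path_to_root k x : (k <= N)%N -> L k x ->
  exists2 q, path (adj (r := G)) x q & last x q = r.
Proof.
elim: k x => [|k IH] x kN Lx; first by exists [::] => //; move: Lx; rewrite L0.
have [q pq eq] := IH _ (ltnW kN) (Lp Lx).
exists (p x :: q) => //=; rewrite pq andbT.
by apply/level_adjP; right; exists k; split=> //; apply: Lp.
Qed.

Lemma level_graph_tree : is_rooted_tree G.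
Proof.
split.
- by exists 0%N => //=; rewrite L0.
- move=> x y /level_adjP[] [k [kN Lx Ly _]].
    by split; [exists k => //=; apply: ltnW|exists k.+1].
  by split; [exists k.+1|exists k => //=; apply: ltnW].
- by move=> x; apply/level_adjP => -[] [k [_ La Lb _]]; have := L_inj La Lb; lia.
- exact: level_adj_sym.
move=> x y [k /= kN Lx] [l /= lN Ly].
have [q pq eq] := level_path_to_root kN Lx.
have [q' pq' eq'] := level_path_to_root lN Ly.
(* Up from x to the root, then down to y; [shortenP] cuts out the repetitions. *)
pose s := q ++ rev (belast y q').
have ps : path (adj (r := G)) x s.
  rewrite cat_path pq eq -eq' rev_path /=.
  by move: pq'; apply: sub_path => z w; rewrite level_adj_sym.
have es : last x s = y.
  rewrite last_cat eq.
  by case: (q') eq' => [/= ->//|z w _]; rewrite /= rev_cons last_rcons.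
case: (shortenP ps) es => s' ps' us' _ es.
exists s'; split=> // t [pt ut et].
exact: (simple_path_unique Lx Ly).
Qed.

End LevelGraph.

Lemma level_graph_iso (T T' : eqType) (N : nat) (L : nat -> set T)
    (L' : nat -> set T') (p : T -> T) (p' : T' -> T') (r : T) (r' : T')
    (f : T -> T') :
  (forall k v, L k.+1 v -> L k (p v)) ->
  (forall k k' v, L' k v -> L' k' v -> k = k') ->
  (forall k, set_bij (L k) (L' k) f) ->
  (forall k v, L k.+1 v -> f (p v) = p' (f v)) ->
  f r = r' ->
  is_rooted_iso (T1 := level_graph N L p r) (T2 := level_graph N L' p' r') f.
Proof.
move=> Lp L'_inj fbij fp fr.
have fL k v : L k v -> L' k (f v) by case: (fbij k) => + _ _; apply.
have f_inj k v w : L k v -> L k w -> f v = f w -> v = w.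
  by case: (fbij k) => _ + _ Lv Lw; apply; rewrite inE.
(* Disjointness of the levels [L'] fixes the level of each image, so injectivity on one level
   recovers [p y = x] from [p' (f y) = f x]. *)
have childP x y i j : L i x -> L j y ->
    (exists k k' : nat, [/\ (k < k' <= N)%N, L' k (f x), L' k' (f y),
       k' = k.+1 & p' (f y) = f x]) <->
    (exists k k' : nat, [/\ (k < k' <= N)%N, L k x, L k' y, k' = k.+1 & p y = x]).
  move=> Lx Ly; split=> -[k [k' [kk' Lk Lk' e pe]]]; subst k'; exists k, k.+1.
    have ek := L'_inj _ _ _ (fL _ _ Lx) Lk; have ej := L'_inj _ _ _ (fL _ _ Ly) Lk'.
    subst i j; split=> //; apply: (f_inj k) => //; first exact: Lp.
    by rewrite (fp k).
  by split=> //; [apply: fL|apply: fL|rewrite -(fp k) // pe].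
split=> //.
  split=> [x [k kN Lx]|x y|y [k kN Ly]].
  - by exists k => //; apply: fL.
  - rewrite !inE => -[k kN Lx] [l lN Ly] e; apply: (f_inj k) => //.
    have Lfx := fL _ _ Lx; rewrite e in Lfx.
    by rewrite (L'_inj _ _ _ Lfx (fL _ _ Ly)).
  - by case: (fbij k) => _ _ /(_ _ Ly)[x Lx <-]; exists x => //; exists k.
move=> x y [i _ Lx] [j _ Ly]; apply: asbool_equiv_eq.
by rewrite (childP x y i j) // (childP y x j i).
Qed.

(** * Counting lattice points on each side of a line *)

Section Counts.
Variable R : realType.
Implicit Types (m n p q : nat) (x y : R).

Definition lower_count m n x : nat :=
  (\sum_(p < m.+1) \sum_(q < n.+1) (q%:R * x <= p%:R)%R)%N.

Definition upper_count m n x : nat :=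
  (\sum_(p < m.+1) \sum_(q < n.+1) (p%:R <= q%:R * x)%R)%N.

(** With p = m + 1 - s and q = t - 1, the inequality s + t x <= (m + 1) + x becomes q x <= p.
    Indices of [tau] start at 1, those of the counted box at 0. *)
Lemma tau_lower m n x : tau m.+1 n.+1 x (m.+1, 1%N) = lower_count m n x.
Proof.
rewrite /tau big_add1 /= big_mkord [RHS](reindex_inj rev_ord_inj) /=.
apply: eq_bigr => p _; rewrite big_add1 /= big_mkord; apply: eq_bigr => q _.
rewrite subSS natrB; last by rewrite -ltnS.
by congr nat_of_bool; rewrite !mulrSr; apply/idP/idP; lra.
Qed.

Lemma tau_upper m n x : tau m.+1 n.+1 x (1%N, n.+1) = upper_count m n x.
Proof.
rewrite /tau big_add1 /= big_mkord; apply: eq_bigr => p _.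
rewrite big_add1 /= big_mkord [RHS](reindex_inj rev_ord_inj) /=.
apply: eq_bigr => q _; rewrite subSS natrB; last by rewrite -ltnS.
by congr nat_of_bool; rewrite !mulrSr; apply/idP/idP; lra.
Qed.

Lemma STatE m n x :
  STat x (m, n) = ((lower_count m n x, upper_count m n x), (m.+1, n.+1)).
Proof. by rewrite /STat /= tau_lower tau_upper. Qed.

(** Transposing the box replaces x by 1/x and exchanges the two sides of the line, so facts about
    one count pass to the other. *)
Lemma lower_count_inv m n x : 0 < x ->
  lower_count m n x^-1 = upper_count n m x.
Proof.
move=> x0; rewrite /lower_count exchange_big; apply: eq_bigr => q _.
by apply: eq_bigr => p _; rewrite ler_pdivrMr.
Qed.

Lemma upper_count_inv m n x : 0 < x ->
  upper_count m n x^-1 = lower_count n m x.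
Proof. by move=> x0; rewrite -lower_count_inv ?invr_gt0 // invrK. Qed.

Lemma leq_upper_count m n x y : x <= y ->
  (upper_count m n x <= upper_count m n y)%N.
Proof.
move=> xy; apply: leq_sum => p _; apply: leq_sum => q _.
case: (leP p%:R (q%:R * x)) => //= pq.
by rewrite (le_trans pq) // ler_wpM2l.
Qed.

Lemma ltn_sum2 m n (F F' : nat -> nat -> bool) p q : (p <= m)%N -> (q <= n)%N ->
  (forall i j, F i j -> F' i j) -> ~~ F p q -> F' p q ->
  (\sum_(i < m.+1) \sum_(j < n.+1) F i j < \sum_(i < m.+1) \sum_(j < n.+1) F' i j)%N.
Proof.
rewrite -(ltnS p) -(ltnS q) => pm qn FF' Fpq F'pq.
have le i j : (F i j <= F' i j)%N by case E: (F i j) => //; rewrite FF'.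
rewrite (bigD1 (Ordinal pm)) //= [ltnRHS](bigD1 (Ordinal pm)) //= -addSn leq_add //; last first.
  by apply: leq_sum => i _; apply: leq_sum.
rewrite (bigD1 (Ordinal qn)) //= [ltnRHS](bigD1 (Ordinal qn)) //= -addSn leq_add //; last first.
  by apply: leq_sum.
by rewrite (negbTE Fpq) F'pq.
Qed.

Lemma ltn_lower_count m n x y p q : (p <= m)%N -> (q <= n)%N -> x <= y ->
  q%:R * x <= p%:R -> p%:R < q%:R * y ->
  (lower_count m n y < lower_count m n x)%N.
Proof.
move=> pm qn xy px py.
apply: (@ltn_sum2 m n (fun p q => q%:R * y <= p%:R) (fun p q => q%:R * x <= p%:R) p q) => //.
  by move=> i j; apply: le_trans; rewrite ler_wpM2l.
by rewrite -ltNge.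
Qed.

(* The half-turn (p, q) |-> (m - p, n - q) of the box. *)
Lemma lower_count_rev m n x :
  lower_count m n x =
  (\sum_(p < m.+1) \sum_(q < n.+1) (p%:R <= q%:R * x + (m%:R - n%:R * x))%R)%N.
Proof.
rewrite /lower_count (reindex_inj rev_ord_inj) /=; apply: eq_bigr => p _.
rewrite (reindex_inj rev_ord_inj) /=; apply: eq_bigr => q _.
rewrite !subSS !natrB; [|by rewrite -ltnS..].
by congr nat_of_bool; apply/idP/idP; lra.
Qed.

Lemma counts_eq m n x : n%:R * x = m%:R -> lower_count m n x = upper_count m n x.
Proof.
move=> e; rewrite lower_count_rev; apply: eq_bigr => p _; apply: eq_bigr => q _.
by rewrite e subrr addr0.
Qed.

(** After the half-turn, the lower count is the upper one with its bound raised by m - n x > 0; the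
    corner (m, n) is gained. *)
Lemma upper_lt_lower m n x : n%:R * x < m%:R ->
  (upper_count m n x < lower_count m n x)%N.
Proof.
move=> h; rewrite lower_count_rev.
apply: (@ltn_sum2 m n (fun p q => p%:R <= q%:R * x)
  (fun p q => p%:R <= q%:R * x + (m%:R - n%:R * x)) m n) => //.
- by move=> i j; lra.
- by rewrite -ltNge.
- by lra.
Qed.

Lemma lower_lt_upper m n x : 0 < x -> m%:R < n%:R * x ->
  (lower_count m n x < upper_count m n x)%N.
Proof.
move=> x0 h; rewrite -lower_count_inv // -[x in lower_count m n x]invrK.
rewrite lower_count_inv ?invr_gt0 //; apply: upper_lt_lower.
by rewrite ltr_pdivrMr.
Qed.

Lemma lower_countS m n x : 0 <= x -> n%:R * x <= m.+1%:R ->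
  lower_count m.+1 n x = (lower_count m n x + n.+1)%N.
Proof.
move=> x0 h; rewrite /lower_count big_ord_recr /=; congr addn.
rewrite (eq_bigr (fun=> 1%N)) ?sum_nat_const ?card_ord ?muln1 // => q _.
rewrite (le_trans _ h) // ler_wpM2r // ler_nat -ltnS; exact: ltn_ord.
Qed.

Lemma upper_countS m n x : 0 <= x -> n%:R * x < m.+1%:R ->
  upper_count m.+1 n x = upper_count m n x.
Proof.
move=> x0 h; rewrite /upper_count big_ord_recr /= [X in (_ + X)%N]big1 ?addn0 // => q _.
apply/eqP; rewrite eqb0 -ltNge (le_lt_trans _ h) // ler_wpM2r // ler_nat -ltnS.
exact: ltn_ord.
Qed.

Lemma upper_countS_eq m n x : 0 < x -> n%:R * x = m.+1%:R ->
  upper_count m.+1 n x = (upper_count m n x).+1.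
Proof.
move=> x0 h; rewrite /upper_count big_ord_recr /= [X in (_ + X)%N]big_ord_recr /=.
rewrite h lexx [X in (_ + (X + _))%N]big1 ?add0n ?addn1 // => q _.
by apply/eqP; rewrite eqb0 -ltNge -h ltr_pM2r // ltr_nat ltn_ord.
Qed.

Lemma STat_pred1 m n x : 0 < x -> n%:R * x < m.+1%:R ->
  ubreve (STat x (m.+1, n)) = STat x (m, n).
Proof.
move=> x0 h; rewrite !STatE /= upper_lt_lower //.
by rewrite lower_countS ?upper_countS ?addnK ?ltW.
Qed.

Lemma STat_pred2 m n x : 0 < x -> m%:R < n.+1%:R * x ->
  ubreve (STat x (m, n.+1)) = STat x (m, n).
Proof.
move=> x0 h; rewrite !STatE /= ltnNge ltnW ?lower_lt_upper //=.
have h' : m%:R * x^-1 < n.+1%:R by rewrite ltr_pdivrMr.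
have x'0 : 0 < x^-1 by rewrite invr_gt0.
rewrite -![lower_count m _ _]upper_count_inv // -![upper_count m _ _]lower_count_inv //.
by rewrite lower_countS ?upper_countS ?addnK ?ltW.
Qed.

End Counts.

(** * Farey intervals *)

(** Stated for any total order, so that the dual order yields predecessors as well. *)
Lemma seq_next d (T : orderType d) (s : seq T) (x y : T) :
  y \in s -> (x < y)%O ->
  exists b, [/\ b \in s, (x < b)%O & forall c, c \in s -> (x < c)%O -> (b <= c)%O].
Proof.
elim: s y => // z s IH y ys xy.
have [/hasP[w ws xw]|/hasPn nos] := boolP (has (fun w => x < w)%O s).
  have [b [bs xb bmin]] := IH _ ws xw.
  have [xz|zx] := ltP x z; last first.
    exists b; split=> //; first by rewrite inE bs orbT.
    move=> c; rewrite inE => /predU1P[->|]; last exact: bmin.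
    by rewrite ltNge zx.
  have [zb|bz] := leP z b.
    exists z; split=> //; first by rewrite mem_head.
    move=> c; rewrite inE => /predU1P[->//|cs xc].
    exact: le_trans zb (bmin _ cs xc).
  exists b; split=> //; first by rewrite inE bs orbT.
  by move=> c; rewrite inE => /predU1P[->|]; [rewrite ltW|exact: bmin].
exists y; split=> // c.
have uniqz w : w \in z :: s -> (x < w)%O -> w = z.
  by rewrite inE => /predU1P[//|/nos /negP].
by move=> /uniqz/[apply] ->; rewrite (uniqz y).
Qed.

Section Farey.
Variable R : realType.
Implicit Types (m n p q k : nat) (x y : R) (a b c : \bar R).
Local Open Scope ereal_scope.

Lemma GsetP m n c : Gset m n c <->
  [\/ c = 0, c = +oo | exists p q, [/\ (1 <= p <= m)%N, (1 <= q <= n)%N &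
                                       c = (p%:R / q%:R)%R%:E]].
Proof.
rewrite /Gset; case: eqP => [mn0|_] /=; last first.
  split=> [[[->|->]|h]|[->|->|h]];
    [exact: Or31|exact: Or32|exact: Or33|by left; left|by left; right|by right].
split=> [[->|->]|[->|->|[p [q [/andP[p1 pm] /andP[q1 qn] _]]]]];
  [exact: Or31|exact: Or32|by left|by right|].
have : (m * n)%N != 0%N by rewrite muln_eq0 negb_or -!lt0n (leq_trans p1) ?(leq_trans q1).
by rewrite mn0.
Qed.

Lemma Gset0 m n : Gset m n (0 : \bar R).
Proof. by apply/GsetP; apply: Or31. Qed.

Lemma Gset_pinfty m n : Gset m n (+oo : \bar R).
Proof. by apply/GsetP; apply: Or32. Qed.

Lemma Gset_frac m n p q : (0 < p <= m)%N -> (0 < q <= n)%N ->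
  Gset m n (p%:R / q%:R : R)%R%:E.
Proof. by move=> hp hq; apply/GsetP; apply: Or33; exists p, q. Qed.

Lemma Gset_sub m n m' n' c : (m <= m')%N -> (n <= n')%N -> Gset m n c -> Gset m' n' c.
Proof.
move=> mm nn /GsetP[->|->|[p [q [/andP[p0 pm] /andP[q0 qn] ->]]]];
  [exact: Gset0|exact: Gset_pinfty|].
by apply: Gset_frac; rewrite ?p0 ?q0 ?(leq_trans pm) ?(leq_trans qn).
Qed.

Lemma Gset_seq m n : exists s : seq (\bar R), forall c, Gset m n c <-> c \in s.
Proof.
exists [:: 0, +oo & [seq (p%:R / q%:R)%R%:E | p <- iota 1 m, q <- iota 1 n]] => c.
rewrite GsetP !inE; split.
  move=> [->|->|[p [q [pm qn ->]]]]; rewrite ?eqxx ?orbT //.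
  apply/orP; right; apply/orP; right; apply: (allpairs_f (fun p q => (p%:R / q%:R)%R%:E));
    by rewrite mem_iota add1n ltnS.
move=> /or3P[/eqP->|/eqP->|/allpairsP[[p q] /= [pm qn ->]]];
  [exact: Or31|exact: Or32|apply: Or33].
by exists p, q; move: pm qn; rewrite !mem_iota !add1n !ltnS.
Qed.

Lemma Gset_next m n a : a < +oo ->
  exists b, [/\ Gset m n b, a < b & forall c, Gset m n c -> a < c -> b <= c].
Proof.
move=> a_lt; have [s sP] := Gset_seq m n.
have [b [bs ab bmin]] := seq_next (proj1 (sP _) (Gset_pinfty m n)) a_lt.
by exists b; split=> //; [apply/sP|move=> c /sP; exact: bmin].
Qed.

Lemma Gset_prev m n b : 0 < b ->
  exists a, [/\ Gset m n a, a < b & forall c, Gset m n c -> c < b -> c <= a].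
Proof.
move=> b_gt; have [s sP] := Gset_seq m n.
have [a [as_ ab amax]] := @seq_next _ (\bar R)^d s b 0 (proj1 (sP _) (Gset0 m n)) b_gt.
by exists a; split=> //; [apply/sP|move=> c /sP; exact: amax].
Qed.

Lemma Gset_ge0 m n c : Gset m n c -> 0 <= c.
Proof.
move=> /GsetP[->|->|[p [q [_ _ ->]]]] //; first exact: leey.
by rewrite lee_fin divr_ge0.
Qed.

Lemma Gint_ge0 m n a b : Gint m n (a, b) -> 0 <= a.
Proof. by case=> /Gset_ge0. Qed.

Lemma Gint_ex m n a b : Gint m n (a, b) -> exists x, a < x%:E < b.
Proof.
case=> /= /Gset_ge0; case: a => [r| |] // r0 _; case: b => [s| |] //= rs _.
  by exists ((r + s) / 2)%R; move: rs; rewrite !lte_fin => rs; apply/andP; split; lra.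
by exists (r + 1)%R; rewrite lte_fin ltry andbT; lra.
Qed.

Lemma Gint_gt0 m n a b x : Gint m n (a, b) -> a < x%:E -> (0 < x)%R.
Proof. by move=> /Gint_ge0 a0 /(le_lt_trans a0); rewrite lte_fin. Qed.

(** For q > 0 the fraction p/q would be an element of [Gset m n] in [x, y], hence strictly between a
    and b. *)
Lemma Gint_sep m n a b x y p q : Gint m n (a, b) -> a < x%:E -> y%:E < b ->
  (p <= m)%N -> (q <= n)%N -> (q%:R * x <= p%:R)%R -> (p%:R <= q%:R * y)%R ->
  p = 0%N /\ q = 0%N.
Proof.
move=> Gab ax yb pm qn xp py; have x0 := Gint_gt0 Gab ax.
have [q0|q0] := posnP q.
  by split=> //; move: py; rewrite q0 mul0r lern0 => /eqP.
have q0' : (0 < q%:R :> R)%R by rewrite ltr0n.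
have p0 : (0 < p)%N by rewrite -(ltr_nat R) (lt_le_trans _ xp) // mulr_gt0.
case: Gab => _ _ _ /(_ (p%:R / q%:R)%R%:E) []; first by apply: Gset_frac; rewrite ?p0 ?q0.
rewrite /= (lt_le_trans ax) ?(le_lt_trans _ yb) // lee_fin.
  by rewrite ler_pdivrMr // mulrC.
by rewrite ler_pdivlMr // mulrC.
Qed.

Lemma Gint_cmp m n a b x y p q : Gint m n (a, b) -> a < x%:E < b -> a < y%:E < b ->
  (p <= m)%N -> (q <= n)%N ->
  ((q%:R * x <= p%:R) = (q%:R * y <= p%:R))%R /\
  ((p%:R <= q%:R * x) = (p%:R <= q%:R * y))%R.
Proof.
move=> Gab.
have imp z w : a < z%:E < b -> a < w%:E < b -> (p <= m)%N -> (q <= n)%N ->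
    ((q%:R * z <= p%:R -> q%:R * w <= p%:R) /\
     (p%:R <= q%:R * z -> p%:R <= q%:R * w))%R.
  move=> /andP[az zb] /andP[aw wb] pm qn.
  split=> h; rewrite leNgt; apply/negP => h'.
    have [p0 q0] := Gint_sep Gab az wb pm qn h (ltW h').
    by move: h'; rewrite p0 q0 mul0r ltxx.
  have [p0 q0] := Gint_sep Gab aw zb pm qn (ltW h') h.
  by move: h'; rewrite p0 q0 mul0r ltxx.
move=> ax ay pm qn.
have [xy1 xy2] := imp _ _ ax ay pm qn; have [yx1 yx2] := imp _ _ ay ax pm qn.
by split; apply/idP/idP.
Qed.

Lemma Gint_counts m n a b x y : Gint m n (a, b) -> a < x%:E < b -> a < y%:E < b ->
  lower_count m n x = lower_count m n y /\ upper_count m n x = upper_count m n y.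
Proof.
move=> Gab ax ay; split; apply: eq_bigr => p _; apply: eq_bigr => q _;
  have [e1 e2] := Gint_cmp Gab ax ay (ltn_ord p) (ltn_ord q);
  congr nat_of_bool; [exact: e1|exact: e2].
Qed.

Lemma Gint_STat m n a b x y : Gint m n (a, b) -> a < x%:E < b -> a < y%:E < b ->
  STat x (m, n) = STat y (m, n).
Proof. by move=> Gab ax ay; rewrite !STatE; have [-> ->] := Gint_counts Gab ax ay. Qed.

(** The interval is nonempty, so [xget] does not return its default 1, and its choice may be
    replaced by any x because the counts are constant on the interval. *)
Lemma STbreveE m n a b x : Gint m n (a, b) -> a < x%:E < b ->
  STbreve ((a, b), (m, n)) = STat x (m, n).
Proof.
move=> Gab ax; rewrite /STbreve; apply: (Gint_STat Gab) => //.
exact: (xgetPex 1%R (Gint_ex Gab)).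
Qed.

(** The positive reals outside G_{m,n}, that is, the union of its Farey intervals, described without
    division. *)
Definition generic m n x := (0 < x)%R /\
  forall p q, (0 < p <= m)%N -> (0 < q <= n)%N -> (q%:R * x)%R != p%:R.

Lemma Gint_generic m n a b x : Gint m n (a, b) -> a < x%:E < b -> generic m n x.
Proof.
move=> Gab /andP[ax xb]; split=> [|p q /andP[p0 pm] /andP[q0 qn]].
  exact: Gint_gt0 Gab ax.
apply/eqP => e; have [] := Gint_sep Gab ax xb pm qn; rewrite ?e //.
by move=> p0'; rewrite p0' in p0.
Qed.

Lemma generic_Gint m n x : generic m n x -> exists a b, Gint m n (a, b) /\ a < x%:E < b.
Proof.
move=> [x0 xG]; have [a [Ga ax amax]] := Gset_prev m n (b := x%:E) x0.
have [b [Gb xb bmin]] := Gset_next m n (ltry x).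
exists a, b; split; last by rewrite ax xb.
split=> //=; first exact: lt_trans xb.
move=> c Gc /andP[ac cb].
have [cx|xc|cx] := ltgtP c x%:E.
- by have := amax _ Gc cx; rewrite leNgt ac.
- by have := bmin _ Gc xc; rewrite leNgt cb.
case/GsetP: Gc cx => [->|->|[p [q [pm qn ->]]]] //.
  by move=> [x00]; rewrite -x00 ltxx in x0.
move=> [e]; have /eqP[] := xG _ _ pm qn.
by rewrite -e mulrC divfK // pnatr_eq0 -lt0n; case/andP: qn.
Qed.

Lemma Gint_eq_or_lt m n a b a' b' : Gint m n (a, b) -> Gint m n (a', b') ->
  [\/ (a, b) = (a', b'), b <= a' | b' <= a].
Proof.
move=> [/= Ga Gb ab hab] [/= Ga' Gb' ab' hab'].
have [aa'|aa'|aa'] := ltgtP a a'.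
- by apply: Or32; rewrite leNgt; apply/negP => a'b; apply: (hab a' Ga'); rewrite aa'.
- by apply: Or33; rewrite leNgt; apply/negP => ab''; apply: (hab' a Ga); rewrite aa'.
subst a'; have [bb|bb|->] := ltgtP b b'; last exact: Or31.
  by case: (hab' b Gb); rewrite ab bb.
by case: (hab b' Gb'); rewrite ab' bb.
Qed.

(** As 0 < x < b < y, the endpoint b is a fraction p/q; the point (p, q) is counted at x but not at
    y. *)
Lemma ltn_lower_count_Gint m n a b a' b' x y : Gint m n (a, b) -> Gint m n (a', b') ->
  b <= a' -> a < x%:E < b -> a' < y%:E < b' ->
  (lower_count m n y < lower_count m n x)%N.
Proof.
move=> Gab Gab' ba' /andP[ax xb] /andP[a'y yb'].
have bly := le_lt_trans ba' a'y.
have x0 := Gint_gt0 Gab ax.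
case: (Gab) => /= _ /GsetP[b0|b0|[p [q [/andP[p0 pm] /andP[q0 qn] eb]]]] _ _.
- by move: xb; rewrite b0 lte_fin ltNge ltW.
- by move: bly; rewrite b0.
have q0' : (0 < q%:R :> R)%R by rewrite ltr0n.
move: xb bly; rewrite eb !lte_fin ltr_pdivlMr // ltr_pdivrMr // => xb bly.
apply: (ltn_lower_count pm qn); rewrite 1?mulrC ?(ltW xb) //.
by rewrite -(ler_pM2r q0') ltW // (lt_trans xb).
Qed.

Lemma STbreve_inj m n a b a' b' : Gint m n (a, b) -> Gint m n (a', b') ->
  STbreve ((a, b), (m, n)) = STbreve ((a', b'), (m, n)) -> (a, b) = (a', b').
Proof.
move=> Gab Gab'; have [x ax] := Gint_ex Gab; have [y ay] := Gint_ex Gab'.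
rewrite (STbreveE Gab ax) (STbreveE Gab' ay) !STatE => -[exy _].
have [//|ba'|b'a] := Gint_eq_or_lt Gab Gab'.
  by have := ltn_lower_count_Gint Gab Gab' ba' ax ay; rewrite exy ltnn.
by have := ltn_lower_count_Gint Gab' Gab b'a ay ax; rewrite exy ltnn.
Qed.

End Farey.

(** * The parent maps and the bijections ST *)

Section Vmap.
Variable R : realType.
Implicit Types (m n p q k : nat) (x y : R) (a b c : \bar R).
Local Open Scope ereal_scope.

(** G_{m,n} is finite, so the minimum exists and [xget] does not return its default value. *)
Lemma set_min_next m n a : a < +oo ->
  let b := set_min [set c | Gset m n c /\ a < c] in
  [/\ Gset m n b, a < b & forall c, Gset m n c -> a < c -> b <= c].
Proof.
move=> a_lt; have [b [Gb ab bmin]] := Gset_next m n a_lt.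
have : exists b, ([set c | Gset m n c /\ a < c] `&` lbound [set c | Gset m n c /\ a < c]) b.
  by exists b; split=> // c [Gc ac]; exact: bmin.
move=> /(xgetPex 0)[[Gm am] lm] /=; split=> // c Gc ac.
by apply: lm.
Qed.

Lemma set_max_prev m n b : 0 < b ->
  let a := set_max [set c | Gset m n c /\ c < b] in
  [/\ Gset m n a, a < b & forall c, Gset m n c -> c < b -> c <= a].
Proof.
move=> b_gt; have [a [Ga ab amax]] := Gset_prev m n b_gt.
have : exists a, ([set c | Gset m n c /\ c < b] `&` ubound [set c | Gset m n c /\ c < b]) a.
  by exists a; split=> // c [Gc cb]; exact: amax.
move=> /(xgetPex 0)[[Gm mb] um] /=; split=> // c Gc cb.
by apply: um.
Qed.

Lemma Gint_axis m n : (m * n)%N = 0%N -> Gint m n (0 : \bar R, +oo).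
Proof.
move=> mn; split=> /=; [exact: Gset0|exact: Gset_pinfty|exact: ltey|].
by move=> c; rewrite /Gset mn eqxx /= => -[->|->]; rewrite ltxx ?andbF.
Qed.

Lemma Gint_axis_eq m n a b : (m * n)%N = 0%N -> Gint m n (a, b) -> (a, b) = (0, +oo).
Proof.
move=> mn Gab; have [//|+|] := Gint_eq_or_lt Gab (Gint_axis mn).
- case: Gab => /= /Gset_ge0 a0 _ ab _ b0.
  by have := lt_le_trans (le_lt_trans a0 ab) b0; rewrite ltxx.
- case: Gab => /= _ _ ab _; rewrite leye_eq => /eqP ea.
  by move: ab; rewrite ea ltNge leey.
Qed.

(* The fractions lost when passing from G_{m+1,n} to G_{m,n} are (m+1)/q with
   q <= n, hence at least (m+1)/n. *)
Lemma Gset_pred1 m n c : Gset m.+1 n c -> c < (m.+1%:R / n%:R : R)%R%:E -> Gset m n c.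
Proof.
move=> /GsetP[->|->|[p [q [/andP[p0 pm] /andP[q0 qn] ->]]]] h;
  [exact: Gset0|exact: Gset_pinfty|].
apply: Gset_frac; rewrite ?q0 // p0 /=; move: pm; rewrite leq_eqVlt => /predU1P[ep|//].
move: h; rewrite ep lte_fin ltr_pM2l ?ltr0n // ltf_pV2 ?posrE ?ltr0n ?(leq_trans q0) //.
by rewrite ltr_nat ltnNge qn.
Qed.

(** The fractions lost here are p/(n+1) with p <= m, hence at most m/(n+1). *)
Lemma Gset_pred2 m n c : Gset m n.+1 c -> (m%:R / n.+1%:R : R)%R%:E < c -> Gset m n c.
Proof.
move=> /GsetP[->|->|[p [q [/andP[p0 pm] /andP[q0 qn] ->]]]] h;
  [exact: Gset0|exact: Gset_pinfty|].
apply: Gset_frac; rewrite ?p0 // q0 /=; move: qn; rewrite leq_eqVlt => /predU1P[ep|//].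
by move: h; rewrite ep lte_fin ltr_pM2r ?invr_gt0 ?ltr0n // ltr_nat ltnNge pm.
Qed.

(** All cases of the definition merge: the new interval contains the old one, so one x serves both
    levels, and the sign of n x - m, which also governs [ubreve], tells which coordinate is
    lowered. *)
Lemma Vbreve_spec m n a b : Gint m n (a, b) -> (0 < m + n)%N ->
  exists a' b' m' n', [/\ Vbreve ((a, b), (m, n)) = ((a', b'), (m', n')),
    Gint m' n' (a', b'), a' <= a, b <= b' &
    [/\ m = m'.+1, n' = n & forall x, a < x%:E < b -> (n%:R * x < m%:R)%R] \/
    [/\ m' = m, n = n'.+1 & forall x, a < x%:E < b -> (m%:R < n%:R * x)%R]].
Proof.
move=> Gab mn; rewrite /Vbreve.
case: m => [|m] in Gab mn *.
  case: n => [//|n] in Gab mn *; have [-> ->] := Gint_axis_eq (mul0n _) Gab.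
  exists 0, +oo, 0%N, n; split=> //; first exact: Gint_axis.
  by right; split=> // x /andP[]; rewrite lte_fin => x0 _; rewrite mulr_gt0 ?ltr0n.
case: n => [|n] in Gab mn *.
  have [-> ->] := Gint_axis_eq (muln0 _) Gab.
  exists 0, +oo, m, 0%N; split=> //; first by apply: Gint_axis; rewrite muln0.
  by left; split=> // x _; rewrite mul0r ltr0n.
rewrite /=; set r := (m.+1%:R / n.+1%:R)%R.
have n0 : (0 < n.+1%:R :> R)%R by rewrite ltr0n.
have lr x : (n.+1%:R * x < m.+1%:R)%R = (x < r)%R by rewrite ltr_pdivlMr // mulrC.
have rl x : (m.+1%:R < n.+1%:R * x)%R = (r < x)%R by rewrite ltr_pdivrMr // mulrC.
case: (Gab) => /= Ga Gb ab hab.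
have sub1 c : Gset m n.+1 c -> Gset m.+1 n.+1 c by apply: Gset_sub.
have sub2 c : Gset m.+1 n c -> Gset m.+1 n.+1 c by apply: Gset_sub.
case: ifPn => [br|].
  exists a, b, m, n.+1; split=> //; last first.
    left; split=> // x /andP[_ xb]; rewrite lr -lte_fin; exact: lt_trans xb br.
  split=> //=; [by apply: Gset_pred1; rewrite // (lt_trans ab)|exact: Gset_pred1|].
  by move=> c /sub1; exact: hab.
rewrite -leNgt le_eqVlt eq_sym => /predU1P[br|rb].
  rewrite br eqxx.
  have ar : a < r%:E by rewrite -br.
  have [Gb' ab' bmin] := set_min_next m n.+1 (lt_trans ar (ltry r)).
  set b' := set_min _ in Gb' ab' bmin *.
  exists a, b', m, n.+1; split=> //.
  - split=> //=; first exact: Gset_pred1.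
    by move=> c Gc /andP[ac cb]; have := bmin _ Gc ac; rewrite leNgt cb.
  - rewrite -br leNgt; apply/negP => b'b; apply: (hab b'); first exact: sub1.
    by rewrite ab' b'b.
  - by left; split=> // x /andP[_]; rewrite lr.
(* The ratio r is itself an element of G_{m+1,n+1}, so it cannot lie strictly between a and b. *)
have ra : r%:E <= a.
  rewrite leNgt; apply/negP => ar; apply: (hab r%:E); last by rewrite ar rb.
  by apply: Gset_frac; rewrite leqnn.
rewrite [b == _]gt_eqF //.
have rx x : a < x%:E < b -> (m.+1%:R < n.+1%:R * x)%R.
  by move=> /andP[ax _]; rewrite rl -lte_fin; exact: le_lt_trans ra ax.
have Gb' : Gset m.+1 n b by exact: Gset_pred2.
case: eqVneq => [ar|ar].
  have b0 : 0 < b by apply: le_lt_trans ab; exact: Gset_ge0 Ga.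
  have [Ga' ab' amax] := set_max_prev m.+1 n b0.
  set a' := set_max _ in Ga' ab' amax *.
  exists a', b, m.+1, n; split=> //; last by right.
    split=> //= c Gc /andP[ac cb].
    by have := amax _ Gc cb; rewrite leNgt ac.
  rewrite leNgt; apply/negP => aa'; apply: (hab a'); first exact: sub2.
  by rewrite aa' ab'.
exists a, b, m.+1, n; split=> //; last by right.
split=> //=; first by apply: Gset_pred2 => //; rewrite lt_neqAle eq_sym ar.
by move=> c /sub2; exact: hab.
Qed.

Lemma Gbreve_Vbreve k (v : Gvertex R) : Gbreve k.+1 v -> Gbreve k (Vbreve v).
Proof.
move: v => [[a b] [m n]] [[m0 n0] mn [Gab [? ?]]]; subst m0 n0.
rewrite /= in mn Gab.
have [|a' [b' [m' [n' [-> Gab' _ _ mn']]]]] := Vbreve_spec Gab; first by rewrite mn.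
exists (m', n') => //=; case: mn' => [[em en _]|[em en _]]; move: mn; rewrite em en /=; lia.
Qed.

Lemma STbreve_Vbreve k (v : Gvertex R) : Gbreve k.+1 v ->
  STbreve (Vbreve v) = ubreve (STbreve v).
Proof.
move: v => [[a b] [m n]] [[m0 n0] mn [Gab [? ?]]]; subst m0 n0.
rewrite /= in mn Gab.
have [|a' [b' [m' [n' [-> Gab' a'a bb' mn']]]]] := Vbreve_spec Gab; first by rewrite mn.
have [x axb] := Gint_ex Gab; have /andP[ax xb] := axb.
have x0 := Gint_gt0 Gab ax.
rewrite (STbreveE Gab axb) (STbreveE (x := x) Gab'); last first.
  by rewrite (le_lt_trans a'a) // (lt_le_trans xb).
case: mn' => [[em en h]|[em en h]].
  by subst m n'; rewrite STat_pred1 //; exact: h.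
by subst n m'; rewrite STat_pred2 //; exact: h.
Qed.

End Vmap.

(** * Young terminal pairs and generic slopes *)

Section Young.
Variable R : realType.
Implicit Types (m n p q k i j : nat) (x y : R).

Lemma tau_lt m n x i j i' j' : (0 < i' <= m)%N -> (0 < j' <= n)%N ->
  i%:R + j%:R * x < i'%:R + j'%:R * x -> (tau m n x (i, j) < tau m n x (i', j'))%N.
Proof.
case: i' => [|i'] // /andP[_ im]; case: j' => [|j'] // /andP[_ jn] lt.
case: m im => [//|m] im; case: n jn => [//|n] jn.
rewrite /tau /= !big_add1 /= !big_mkord.
under eq_bigr do rewrite big_add1 /= big_mkord.
under [ltnRHS]eq_bigr do rewrite big_add1 /= big_mkord.
apply: (@ltn_sum2 m n (fun s t => s.+1%:R + t.+1%:R * x <= i%:R + j%:R * x)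
  (fun s t => s.+1%:R + t.+1%:R * x <= i'.+1%:R + j'.+1%:R * x) i' j') => //.
  by move=> s t h; apply: le_trans h (ltW lt).
by rewrite -ltNge.
Qed.

(** The cells (p + 1, 1) and (1, q + 1) have the same i + j x when q x = p; conversely, a
    coincidence of i + j x at two distinct cells gives such an equation for the differences of their
    coordinates. *)
Lemma tau_injP m n x : 0 < x ->
  set_inj (box m.+1 n.+1) (tau m.+1 n.+1 x) <-> generic m n x.
Proof.
move=> x0; split=> [inj|[_ xG]].
  split=> // p q /andP[p0 pm] /andP[q0 qn]; apply/eqP => e.
  have : (p.+1, 1%N) = (1%N, q.+1).
    apply: inj; rewrite ?inE /box /= ?ltnS ?pm ?qn //.
    rewrite /tau /=; apply: eq_bigr => s _; apply: eq_bigr => t _.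
    by congr (nat_of_bool (_ <= _)); rewrite !mulrSr -e; ring.
  by move=> [p00 _]; rewrite p00 in p0.
move=> [i j] [i' j']; rewrite !inE /box /= => -[im jn] [im' jn'] e.
have [lt|lt|eqv] := ltgtP (i%:R + j%:R * x) (i'%:R + j'%:R * x).
- by have := tau_lt im' jn' lt; rewrite e ltnn.
- by have := tau_lt im jn lt; rewrite e ltnn.
have sep u v u' v' : (0 < u <= m.+1)%N -> (0 < v <= n.+1)%N ->
    (0 < u' <= m.+1)%N -> (0 < v' <= n.+1)%N ->
    u%:R + v%:R * x = u'%:R + v'%:R * x -> (u < u')%N -> False.
  move=> um vn um' vn' h uu'.
  have vv : (v' < v)%N.
    rewrite -(ltr_nat R) -(ltr_pM2r x0).
    by move: uu'; rewrite -(ltr_nat R); lra.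
  have /eqP[] : (v - v')%:R * x != (u' - u)%:R by apply: xG; lia.
  by rewrite !natrB 1?ltnW //; lra.
have [ii|ii|ii] := ltngtP i i'.
- by case: (sep _ _ _ _ im jn im' jn' eqv ii).
- by case: (sep _ _ _ _ im' jn' im jn (esym eqv) ii).
subst i'; congr pair; move: eqv => /addrI /(mulIf (lt0r_neq0 x0)) /eqP.
by rewrite eqr_nat => /eqP.
Qed.

Lemma TYP m n v : TY R m.+1 n.+1 v <-> exists2 x : R, generic m n x & v = STat x (m, n).
Proof.
split=> [[theta [x [x0 -> /tau_injP inj]] <-]|[x xG ->]].
  by exists x; [exact: inj|].
exists (tau m.+1 n.+1 x) => //; exists x; have x0 := proj1 xG.
by split=> //; apply/tau_injP.
Qed.

Lemma TYbreveP k v : TYbreve R k.+2 v <->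
  exists m n, (m + n)%N = k /\ exists2 x : R, generic m n x & v = STat x (m, n).
Proof.
split=> [[[[|m] [|n]] /= [] // _ _ mn /TYP xv]|[m [n [mn xv]]]].
  by exists m, n; split=> //; lia.
by exists (m.+1, n.+1) => /=; [split=> //; lia|apply/TYP].
Qed.

Lemma STbreve_bij k : set_bij (@Gbreve R k) (TYbreve R k.+2) (@STbreve R).
Proof.
split.
- move=> [[a b] [m n]] [[m0 n0] /= mn [Gab [? ?]]]; subst m0 n0; apply/TYbreveP.
  exists m, n; split=> //; have [x axb] := Gint_ex Gab.
  by exists x; [exact: Gint_generic axb|exact: STbreveE].
- move=> [[a b] [m n]] [[a' b'] [m' n']]; rewrite !inE.
  move=> [[i j] _ [Gab [-> ->]]] [[i' j'] _ [Gab' [-> ->]]] /= e.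
  rewrite /= in Gab Gab'.
  have [ei ej] : i = i' /\ j = j' by case: e.
  by subst i' j'; rewrite (STbreve_inj Gab Gab' e).
- move=> v /TYbreveP[m [n [mn [x xG ->]]]].
  have [a [b [Gab axb]]] := generic_Gint xG.
  by exists ((a, b), (m, n)); [exists (m, n)|exact: STbreveE].
Qed.

End Young.

(** * Solutions of the difference equations *)

Section Terminal.
Implicit Types (m n i j : nat) (f : nat * nat -> nat).

Lemma E1in_swap m n f : E1in m n f -> E1in n m (f \o swap_pair).
Proof.
have boxS i j u : (box i 1 `|` box 1 j) u -> (box j 1 `|` box 1 i) (swap_pair u).
  by move=> [[u1 u2]|[u1 u2]]; [right|left].
move=> [f_fun f_inj f1 fl fr]; split=> //=.
- by move=> u /boxS/f_fun; rewrite mulnC.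
- move=> u v; rewrite !inE => /boxS hu /boxS hv /f_inj e.
  by apply: (can_inj swap_pairK); apply: e; rewrite inE.
Qed.

Section Steps.
Variables (m n : nat) (f : nat * nat -> nat).
Hypothesis fE : E1in m n f.

Lemma E1in_stepl i : (0 < i < m)%N ->
  f (i.+1, 1)%N = (f (i, 1) + \sum_(1 <= t < n.+1) (f (1, t) <= f (i.+1, 1)))%N.
Proof.
move=> im; case: fE => _ _ _ /(_ i) + _.
have -> : (0 < i <= m.-1)%N by lia.
by move=> /(_ isT)/(canRL (subrK _)) /eqP; rewrite -PoszD eqz_nat addnC => /eqP.
Qed.

Lemma E1in_stepr j : (0 < j < n)%N ->
  f (1, j.+1)%N = (f (1, j) + \sum_(1 <= s < m.+1) (f (s, 1) <= f (1, j.+1)))%N.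
Proof.
move=> jn; case: fE => _ _ _ _ /(_ j).
have -> : (0 < j <= n.-1)%N by lia.
by move=> /(_ isT)/(canRL (subrK _)) /eqP; rewrite -PoszD eqz_nat addnC => /eqP.
Qed.

Lemma E1in_monor j j' : (0 < j)%N -> (j <= j' <= n)%N -> (f (1, j) <= f (1, j'))%N.
Proof.
move=> j0; elim: j' => [|j' IH] h; first by lia.
have [->//|jj'] := eqVneq j j'.+1.
apply: leq_trans (IH _) _; first by lia.
by rewrite (E1in_stepr (j := j')) ?leq_addr //; lia.
Qed.

End Steps.

Lemma E1in_pred m n f : E1in m.+2 n.+1 f -> (f (1, n.+1) < f (m.+2, 1))%N ->
  E1in m.+1 n.+1 f /\ f (m.+2, 1)%N = (f (m.+1, 1) + n.+1)%N.
Proof.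
move=> fE lt; have [f_fun f_inj f1 fl fr] := fE.
have step : f (m.+2, 1)%N = (f (m.+1, 1) + n.+1)%N.
  rewrite (E1in_stepl fE) ?ltnSn //; congr addn.
  rewrite big_nat (eq_bigr (fun=> 1%N)) => [|t /andP[t0 tn]].
    by rewrite -big_nat sum_nat_const_nat subSS subn0 muln1.
  by rewrite (leq_trans (E1in_monor fE t0 (j' := n.+1) _)) ?(ltnW lt) ?leqnn ?andbT.
have boxS u : (box m.+1 1 `|` box 1 n.+1) u -> (box m.+2 1 `|` box 1 n.+1) u.
  by move=> [[/andP[u1 um] u2]|u12]; [left; split; rewrite // u1 ltnW|right].
have stepr j : (1 <= j <= n)%N -> f (1, j.+1)%N =
    (f (1, j) + \sum_(1 <= s < m.+2) (f (s, 1) <= f (1, j.+1)))%N.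
  move=> jn; rewrite [LHS](E1in_stepr fE); last by lia.
  rewrite big_nat_recr //=.
  rewrite [(_ <= _)%N as X in nat_of_bool X]leqNgt.
  have jn' : (j.+1 <= n.+1 <= n.+1)%N by lia.
  by rewrite (leq_ltn_trans (E1in_monor fE (ltn0Sn j) jn') lt) addn0.
(* Each of the j - 1 horizontal steps adds at most m + 1, which keeps f(1, j) within (m + 1)(n +
   1). *)
have ler j : (0 < j <= n.+1)%N -> (f (1, j) <= 1 + m.+1 * j.-1)%N.
  case: j => // j; elim: j => [|j IH] h; first by rewrite f1; lia.
  rewrite stepr //.
  have : (\sum_(1 <= s < m.+2) (f (s, 1) <= f (1, j.+2)) <= m.+1)%N.
    apply: (@leq_trans (\sum_(1 <= s < m.+2) 1)); last first.
      by rewrite sum_nat_const_nat subSS subn0 muln1.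
    by apply: leq_sum => s _; exact: leq_b1.
  have := IH (ltnW h); rewrite /= mulnS; lia.
split=> //; split=> //.
- move=> u bu; have /= /andP[-> _] := f_fun _ (boxS _ bu); rewrite /=.
  case: u bu => i j [[/= im j1]|[/= i1 jn]].
    have -> : j = 1%N by lia.
    have : (f (i, 1) <= f (m.+1, 1))%N.
      by have := E1in_monor (E1in_swap fE) (j := i) (j' := m.+1); apply; lia.
    (* Subtracting the last step n + 1 from the bound (m + 2)(n + 1) leaves exactly (m + 1)(n +
       1). *)
    have /= /andP[_] : (1 <= f (m.+2, 1) <= m.+2 * n.+1)%N.
      by apply: f_fun; left; split=> //=; rewrite leqnn.
    by rewrite step; lia.
  have -> : i = 1%N by lia.
  apply: leq_trans (ler _ jn) _.
  by rewrite mulnS leq_add // leq_mul2l; lia.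
- by move=> u v; rewrite !inE => /boxS hu /boxS hv; apply: f_inj; rewrite inE.
- by move=> i /= im; apply: fl => /=; lia.
- by move=> j /= jn; rewrite [in LHS]stepr // PoszD addrC addKr.
Qed.

End Terminal.

(** * Young terminal pairs are those of the difference equations *)

Section YoungTerminal.
Variable R : realType.
Implicit Types (m n p q k i j : nat) (x y z : R) (f : nat * nat -> nat).

Lemma tau_swap m n x i j : 0 < x -> tau n m x^-1 (j, i) = tau m n x (i, j).
Proof.
move=> x0; rewrite /tau exchange_big /=; apply: eq_bigr => s _; apply: eq_bigr => t _.
congr nat_of_bool; rewrite -(ler_pM2r x0) !mulrDl -!mulrA mulVf ?lt0r_neq0 // !mulr1.
by rewrite addrC [in X in (_ <= X)]addrC.
Qed.

Lemma tau_le m n x i j i' j' : (0 < i <= m)%N -> (0 < j <= n)%N ->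
  (tau m n x (i, j) <= tau m n x (i', j'))%N = (i%:R + j%:R * x <= i'%:R + j'%:R * x).
Proof.
move=> im jn; apply/idP/idP => [|le].
  by rewrite leNgt leqNgt; apply: contra; exact: tau_lt.
apply: leq_sum => s _; apply: leq_sum => t _.
case: (leP (s%:R + t%:R * x) _) => //= h.
by rewrite (le_trans h le).
Qed.

(* Exactly one integer lies in the half-open interval (z, z + 1]. *)
Lemma count_leD1 m z : z < m%:R ->
  (\sum_(1 <= s < m.+1) (s%:R <= z + 1)%R =
   \sum_(1 <= s < m.+1) (s%:R <= z)%R + (1 <= z + 1)%R)%N.
Proof.
rewrite !big_add1 /= !big_mkord; case: m => [|m] zm.
  rewrite !big_ord0 (_ : (1 <= z + 1) = false) //.
  by apply/negbTE; rewrite -ltNge; lra.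
have mz : (m.+1%:R <= z) = false by rewrite leNgt zm.
rewrite big_ord_recl [in RHS]big_ord_recr /= mz addn0 addnC; congr addn.
apply: eq_bigr => s _; congr nat_of_bool.
by rewrite /bump /= add1n [in LHS]mulrSr lerD2r.
Qed.

(** For each fixed t, raising i by 1 admits one more s exactly when 1 + t x <= (i + 1) + x, which by
    [tau_le] is the comparison of [tau] at (1, t) and (i + 1, 1). *)
Lemma tau_step m n x i : 0 < x -> (0 < i < m)%N ->
  tau m n x (i.+1, 1%N) = (tau m n x (i, 1%N) +
    \sum_(1 <= t < n.+1) (tau m n x (1%N, t) <= tau m n x (i.+1, 1%N)))%N.
Proof.
move=> x0 im; have m0 : (0 < m)%N by lia.
under [X in (_ + X)%N]eq_big_nat => t tn do rewrite tau_le ?tn //.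
rewrite /tau exchange_big [X in (X + _)%N]exchange_big /= -big_split /=.
rewrite !big_nat; apply: eq_bigr => t /andP[t0 tn].
have tR : 1 <= t%:R :> R by rewrite ler1n.
have iR : i.+1%:R <= m%:R :> R by rewrite ler_nat; lia.
(* The two conditions on s read s <= z and s <= z + 1. As t >= 1 and i < m, z stays below m, so the
   range of s does not cut off the new integer. *)
pose z := i%:R + x - t%:R * x.
have zm : z < m%:R.
  move: iR; rewrite /z mulrSr => iR.
  have : x <= t%:R * x by rewrite ler_peMl // ltW.
  lra.
have up s : (s%:R + t%:R * x <= i.+1%:R + 1%:R * x) = (s%:R <= z + 1).
  by rewrite /z mulrSr; apply/idP/idP; lra.
have low s : (s%:R + t%:R * x <= i%:R + 1%:R * x) = (s%:R <= z).
  by rewrite /z; apply/idP/idP; lra.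
under eq_bigr do rewrite up.
under [X in _ = (X + _)%N]eq_bigr do rewrite low.
by rewrite up; exact: count_leD1.
Qed.

Lemma tau11 m n x : 0 < x -> tau m.+1 n.+1 x (1, 1)%N = 1%N.
Proof.
move=> x0; rewrite /tau /= big_add1 /= big_mkord big_ord_recl /=.
rewrite big_add1 /= big_mkord big_ord_recl /= lexx big1 => [|t _].
  rewrite big1 // => s _; rewrite big_add1 /= big_mkord big1 // => t _.
  apply/eqP; rewrite eqb0 -ltNge /bump /= ltr_leD ?ltr_nat //.
  by rewrite ler_wpM2r ?ler_nat // ltW.
by apply/eqP; rewrite eqb0 -ltNge ltrD2l ltr_pM2r // ltr_nat.
Qed.

Lemma generic_E1in m n x : generic m n x -> E1in m.+1 n.+1 (tau m.+1 n.+1 x).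
Proof.
move=> xG; have x0 := proj1 xG; have /(tau_injP _ _ x0) inj := xG.
have boxS u : (box m.+1 1 `|` box 1 n.+1) u -> box m.+1 n.+1 u.
  by move=> [[/andP[? ?] /andP[? ?]]|[/andP[? ?] /andP[? ?]]];
    split; apply/andP; split; lia.
split.
- move=> [i j] /boxS[/= im jn]; apply/andP; split.
    (* Positivity: (0, 0), outside the box, has a smaller i + j x than every cell. *)
    apply: leq_ltn_trans (@tau_lt R m.+1 n.+1 x 0 0 i j im jn _) => //.
    rewrite mul0r addr0 addr_gt0 ?mulr_gt0 ?ltr0n //; lia.
  apply: (@leq_trans (\sum_(1 <= s < m.+2) \sum_(1 <= t < n.+2) 1)).
    by apply: leq_sum => s _; apply: leq_sum => t _; exact: leq_b1.
  by rewrite !sum_nat_const_nat !subSS !subn0 muln1 mulnC.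
- by move=> u v; rewrite !inE => /boxS hu /boxS hv; apply: inj; rewrite inE.
- exact: tau11.
- by move=> i /= im; rewrite [in LHS]tau_step // PoszD addrC addKr.
(* The horizontal equations are the vertical ones for the transposed box and 1/x. *)
- move=> j /= jn; rewrite -![tau _ _ _ (1%N, _)]tau_swap //.
  rewrite [in LHS]tau_step ?invr_gt0 // PoszD addrC addKr.
  by congr Posz; apply: eq_bigr => s _; rewrite [tau n.+1 _ _ (1%N, s)]tau_swap.
Qed.

(* Lowering x inside its Farey interval makes it compatible with one more
   numerator; if the whole interval lay above (m+1)/n, then comparing the counts
   at x with those at (m+1)/n, where the half-turn symmetry is exact, would give
   lower + n + 1 <= upper. *)
Lemma generic_extend m n x : generic m n x ->
  (upper_count m n x < lower_count m n x + n.+1)%N ->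
  exists y, [/\ generic m.+1 n y, n%:R * y < m.+1%:R,
    lower_count m n y = lower_count m n x & upper_count m n y = upper_count m n x].
Proof.
move=> xG lt; have [a [b [Gab axb]]] := generic_Gint xG.
have /andP[ax xb] := axb; have x0 := Gint_gt0 Gab ax.
have [Ga Gb ab _] := Gab; rewrite /= in Ga Gb ab.
have an : (0 < n)%N -> (a < (m.+1%:R / n%:R)%:E)%E.
  move=> n0; rewrite ltNge; apply/negP => ra.
  have n0' : 0 < n%:R :> R by rewrite ltr0n.
  pose r : R := m.+1%:R / n%:R.
  have r0 : 0 < r by rewrite divr_gt0.
  have nr : n%:R * r = m.+1%:R by rewrite mulrC divfK // lt0r_neq0.
  have rx : r <= x by rewrite -lee_fin (le_trans ra) // ltW.
  case/GsetP: Ga => [a0|a0|[p [q [/andP[p0 pm] /andP[q0 qn] ea]]]].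
  - by move: ra; rewrite a0 lee_fin leNgt r0.
  - by move: ax; rewrite a0.
  have q0' : 0 < q%:R :> R by rewrite ltr0n.
  move: ra ax; rewrite ea lee_fin lte_fin ler_pdivlMr // ltr_pdivrMr // => ra ax'.
  (* The endpoint a = p/q separates r from x, so the lower count drops strictly. This makes up for
     the corner (m+1, n), which lies on the line of slope r and is counted on both sides. *)
  have low : (lower_count m n x < lower_count m n r)%N.
    by apply: (ltn_lower_count pm qn); rewrite // mulrC.
  have up := leq_upper_count m n rx.
  have := counts_eq nr; rewrite upper_countS_eq // lower_countS ?nr ?(ltW r0) //.
  by move: low up lt; lia.
have a_lt : (a < +oo)%E by apply: lt_le_trans ab _; rewrite leey.
(* With c the first element of G_{m+1,n} above a, the interval (a, c) lies in (a, b), so the counts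
   do not change, and for n > 0 it lies below (m+1)/n. *)
have [c [Gc ac cmin]] := Gset_next m.+1 n a_lt.
have Gac : Gint m.+1 n (a, c).
  split=> //=; first exact: Gset_sub Ga.
  by move=> d Gd /andP[ad dc]; have := cmin _ Gd ad; rewrite leNgt dc.
have [y ayc] := Gint_ex Gac; have /andP[ay yc] := ayc.
have ayb : (a < y%:E < b)%E.
  by rewrite ay (lt_le_trans yc) // cmin //; exact: Gset_sub Gb.
have [el eu] := Gint_counts Gab ayb axb.
exists y; split=> //; first exact: Gint_generic ayc.
have [->|n0] := posnP n; first by rewrite mul0r.
have : (y%:E < (m.+1%:R / n%:R)%:E)%E.
  apply: lt_le_trans yc (cmin _ _ (an n0)).
  by apply: Gset_frac; rewrite ?leqnn ?n0.
by rewrite lte_fin ltr_pdivlMr ?ltr0n // mulrC.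
Qed.

Lemma generic_inv m n x : generic m n x -> generic n m x^-1.
Proof.
move=> [x0 xG]; split=> [|p q pn qm]; first by rewrite invr_gt0.
by apply/eqP => e; have /eqP[] := xG _ _ qm pn; rewrite -e divfK // lt0r_neq0.
Qed.

Lemma E1in_generic m n f : E1in m.+1 n.+1 f ->
  exists x, [/\ generic m n x, f (m.+1, 1)%N = lower_count m n x &
                f (1, n.+1)%N = upper_count m n x].
Proof.
move: {2}(m + n)%N (leqnn (m + n)) => k.
elim: k m n f => [|k IH] m n f mnk fE.
  have [-> ->] : m = 0%N /\ n = 0%N by lia.
  have [_ _ f1 _ _] := fE; exists 1.
  split; first by split=> // p q; lia.
    by rewrite -tau_lower tau11.
  by rewrite -tau_upper tau11.
(* The case where the vertical end value is the larger; the opposite case follows from it through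
   [E1in_swap]. *)
have step m' n' g : (m' + n' <= k.+1)%N -> E1in m'.+1 n'.+1 g ->
    (g (1, n'.+1) < g (m'.+1, 1))%N ->
    exists x, [/\ generic m' n' x, g (m'.+1, 1)%N = lower_count m' n' x &
                  g (1, n'.+1)%N = upper_count m' n' x].
  case: m' => [|m'] mnk' gE lt.
    have [g_fun _ g1 _ _] := gE.
    have /= /andP[] : (1 <= g (1, n'.+1) <= 1 * n'.+1)%N.
      by apply: g_fun; right; split=> //=; rewrite leqnn.
    by move: lt; rewrite g1; lia.
  have [gE' e] := E1in_pred gE lt.
  have [x [xG e1 e2]] := IH m' n' g mnk' gE'.
  (* Since g(m'+2, 1) is the lower count plus n' + 1, the condition of [generic_extend] is the
     inequality [lt]. *)
  have [|y [yG ylt el eu]] := generic_extend xG; first by rewrite -e1 -e -e2.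
  have y0 := proj1 yG.
  exists y; split=> //.
    by rewrite lower_countS ?(ltW y0) ?(ltW ylt) // el -e1.
  by rewrite upper_countS ?(ltW y0) // eu.
have [fl|fl|fe] := ltngtP (f (1, n.+1)%N) (f (m.+1, 1)%N).
- exact: step.
- have [|x [xG e1 e2]] := step n m _ _ (E1in_swap fE) fl; first by rewrite addnC.
  have x0 := proj1 xG.
  exists x^-1; split; first exact: generic_inv.
    by rewrite lower_count_inv // -e2.
  by rewrite upper_count_inv // -e1.
(* Equal end values force equal cells, so the box is a single cell and any positive x would do. *)
have [_ f_inj _ _ _] := fE.
have [em en] : (1, n.+1)%N = (m.+1, 1)%N.
  by apply: f_inj => //; rewrite inE; [right|left]; split=> //=; rewrite leqnn.
exists 1; split; first by split=> // p q; lia.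
  by rewrite -tau_lower -em en tau11 //; have [_ _ -> _ _] := fE.
by rewrite -tau_upper -em en tau11 //; have [_ _ -> _ _] := fE.
Qed.

Lemma TY_T1in m n : TY R m.+1 n.+1 = T1in m.+1 n.+1.
Proof.
apply/seteqP; split=> v.
  move=> /TYP[x xG ->]; exists (tau m.+1 n.+1 x); first exact: generic_E1in.
  by [].
move=> [f /E1in_generic[x [xG e1 e2]] <-]; apply/TYP; exists x => //.
by rewrite STatE e1 e2.
Qed.

Lemma TYbreve_Tbreve k : TYbreve R k = Tbreve k.
Proof.
by apply: eq_bigcupr => -[[|m] [|n]] [] // _ _ _; exact: TY_T1in.
Qed.

End YoungTerminal.

(** * Disjointness of levels, the roots, and the tree isomorphism *)

Lemma Tbreve_level k k' (v : Tvertex) : Tbreve k v -> Tbreve k' v -> k = k'.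
Proof.
move=> [[m n] [/= _ _ <-] [f _ <-]] [[m' n'] [/= _ _ <-] [f' _ []]].
by move=> _ _ -> ->.
Qed.

Lemma Gbreve_level (R : realType) k k' (v : Gvertex R) :
  Gbreve k v -> Gbreve k' v -> k = k'.
Proof.
move: v => [[a b] mn] [[m n] /= <- [_ /= ->]] [[m' n'] /= <- [_ /= []]].
by move=> -> ->.
Qed.

Lemma Gbreve0 (R : realType) : Gbreve 0 = [set Groot R].
Proof.
apply/seteqP; split=> [[[a b] mn] [[[|m] [|n]] //= _ [/= Gab ->]]|_ ->].
  by rewrite /= (Gint_axis_eq _ Gab).
by exists (0, 0)%N => //; split=> //; exact: Gint_axis.
Qed.

Theorem corollary1 (R : realType) (N : nat) :
  [/\ is_rooted_tree (TreeGV R N),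
      is_rooted_tree (TreeTu N),
      is_rooted_iso (T1 := TreeGV R N) (T2 := TreeTu N) (@STbreve R) &
      forall k : nat, (k <= N)%N ->
        [/\ forall (a b : \bar R) (mn : nat * nat) (xi : R),
              Gbreve k ((a, b), mn) -> (a < xi%:E < b)%E ->
              STbreve ((a, b), mn) = STat xi mn,
            set_bij (@Gbreve R k) (TYbreve R k.+2) (@STbreve R) &
            TYbreve R k.+2 = Tbreve k.+2]].
Proof.
have root : STbreve (Groot R) = Troot.
  have G0 : Gbreve 0 (Groot R) by rewrite Gbreve0.
  have Gr : Gint 0 0 (0%E : \bar R, +oo%E) by exact: Gint_axis.
  by rewrite (@STbreveE _ _ _ _ _ 1 Gr) ?ltry ?lte_fin ?ltr01 // /STat /= !tau11.
have bij k : set_bij (@Gbreve R k) (Tbreve k.+2) (@STbreve R).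
  by rewrite -(TYbreve_Tbreve R); exact: STbreve_bij.
have Tb_inj k k' v : Tbreve k.+2 v -> Tbreve k'.+2 v -> k = k'.
  by move=> h h'; have [] := Tbreve_level h h'.
split.
- apply: level_graph_tree; [exact: Gbreve0|exact: Gbreve_Vbreve|exact: Gbreve_level].
- apply: level_graph_tree => //.
    have [STf _ STs] := bij 0%N; apply/seteqP; split=> [v /STs[w]|_ ->].
      by rewrite Gbreve0 => -> <-.
    by rewrite -root; apply: STf; rewrite Gbreve0.
  (* Stability of the levels under [ubreve] is carried over from [Vbreve], by surjectivity of ST and
     its commutation with the parent maps. *)
  move=> k v; have [_ _ STs] := bij k.+1; have [STf _ _] := bij k.
  by move=> /STs[w Gw <-]; rewrite -(STbreve_Vbreve Gw); apply: STf; exact: Gbreve_Vbreve.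
- by apply: level_graph_iso => //; [exact: Gbreve_Vbreve|exact: STbreve_Vbreve].
move=> k _; split; [|exact: STbreve_bij|exact: TYbreve_Tbreve].
move=> a b [m n] xi [[m' n'] _ [Gab [em en]]]; rewrite /= in Gab em en.
by subst m' n'; exact: STbreveE.
Qed.
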